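(* Let $X$ be an Abelian group, and let $f, g : X \to (0,\infty)$ be positive functions satisfying the Kac--Bernstein functional equation $$f(x+y)\,g(x-y)=f(x)f(y)g(x)g(-y)\quad\text{for all } x,y\in X.$$ Then there exist functions $P, l, m, r : X\to\mathbb{R}$ such that $$f(x)=\exp\{P(x)+l(x)+r(x)\},\qquad g(x)=\exp\{P(x)+m(x)-r(x)\}\quad\text{for all } x\in X,$$ where $P(x+y)+P(x-y)=2[P(x)+P(y)]$ for all $x,y\in X$; $l(x+y)=l(x)+l(y)$ and $m(x+y)=m(x)+m(y)$ for all $x,y\in X$; and $r$ is constant on each coset of the subgroup $X^{(2)}$ in $X$.
   Context: For an Abelian group $X$ (written additively) and a positive integer $n$, $X^{(n)}=\{nx : x\in X\}$ denotes the image of $X$ under the map $x\mapsto nx$. No topology is placed on $X$, and no regularity of $f, g$ is assumed. *)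

(* Defs.v *)
From HB Require Import structures.
From mathcomp Require Import all_boot all_order all_algebra.
From mathcomp Require Import all_classical all_reals all_analysis.
Set Implicit Arguments.
Unset Strict Implicit.
Unset Printing Implicit Defensive.
Import Order.TTheory GRing.Theory Num.Theory.
Local Open Scope classical_set_scope.
Local Open Scope ring_scope.

(* The subgroup usually written X^(n), i.e. the set of all n x with x in X;
   it is used for n > 0. *)
Definition mul_image (X : zmodType) (n : nat) : set X :=
  range (fun x : X => x *+ n).

Definition add_coset (X : zmodType) (H : set X) (a : X) : set X :=
  [set a + h | h in H].

Definition constant_on_cosets (X : zmodType) (T : Type) (H : set X)
    (r : X -> T) : Prop :=
  forall a x y : X, add_coset H a x -> add_coset H a y -> r x = r y.

(* Main.v *)
(* For F = ln f and G = ln g the equation is linear. Its instances at (x, y)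
   and (-y, -x) show that the odd parts of F and G are additive. The even parts
   then satisfy F(x + y) + G(x - y) = F(x) + F(y) + G(x) + G(y), whose right-hand
   side is invariant under y -> -y: hence F + G is quadratic, while F - G takes
   the same value at x + y and x - y, which differ by 2y. *)
Require Import Defs.
From HB Require Import structures.
From mathcomp Require Import all_boot all_order all_algebra.
From mathcomp Require Import all_classical all_reals all_analysis.
From mathcomp Require Import lra.
Import Order.TTheory GRing.Theory Num.Theory.
Local Open Scope ring_scope.

(** At the pair [a + b], [b] the hypothesis reads [r (a + 2b) = r a], so [r] equals [r a] on the
    whole coset of [a]. *)
Lemma constant_on_cosets_mul_image2 (X : zmodType) (T : Type) (r : X -> T) :
  (forall x y : X, r (x + y) = r (x - y)) ->
  constant_on_cosets (@mul_image X 2) r.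
Proof.
move=> rDB.
have r2 a b : r (a + b *+ 2) = r a by rewrite mulr2n addrA rDB addrK.
by move=> a x y [_ [b _ <-] <-] [_ [c _ <-] <-]; rewrite !r2.
Qed.

Theorem theorem2p1 (R : realType) (X : zmodType) (f g : X -> R)
    (f_gt0 : forall x : X, 0 < f x) (g_gt0 : forall x : X, 0 < g x)
    (kac_bernstein : forall x y : X,
       f (x + y) * g (x - y) = f x * f y * g x * g (- y)) :
  exists P l m r : X -> R,
    (forall x : X, f x = expR (P x + l x + r x)) /\
    (forall x : X, g x = expR (P x + m x - r x)) /\
    (forall x y : X, P (x + y) + P (x - y) = 2 * (P x + P y)) /\
    (forall x y : X, l (x + y) = l x + l y) /\
    (forall x y : X, m (x + y) = m x + m y) /\
    constant_on_cosets (@mul_image X 2) r.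
Proof.
pose F x := ln (f x); pose G x := ln (g x).
have FG x y : F (x + y) + G (x - y) = F x + F y + G x + G (- y).
  by rewrite /F /G -!lnM ?posrE ?mulr_gt0 // kac_bernstein.
have lnfE x : f x = expR (F x) by rewrite lnK ?posrE.
have lngE x : g x = expR (G x) by rewrite lnK ?posrE.
clearbody F G.
(* [P + r] and [P - r] are the even parts of [F] and [G]; [l] and [m] are their odd parts. *)
pose P x := (F x + F (- x) + G x + G (- x)) / 4.
pose l x := (F x - F (- x)) / 2.
pose m x := (G x - G (- x)) / 2.
pose r x := (F x + F (- x) - G x - G (- x)) / 4.
exists P, l, m, r.
have FGNr x y : F (x - y) + G (x + y) = F x + F (- y) + G x + G y.
  by have := FG x (- y); rewrite opprK.
have FGNl x y : F (- x - y) + G (y - x) = F (- x) + F (- y) + G (- x) + G y.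
  by rewrite (addrC y) FGNr.
have FGNN x y : F (y - x) + G (- x - y) = F (- x) + F y + G (- x) + G (- y).
  by rewrite (addrC y) FG.
have FGs x y : F (- x - y) + G (x - y) = F (- y) + F (- x) + G (- y) + G x.
  by have := FGNl y x; rewrite (addrC (- y)).
have FGNrs x y : F (x - y) + G (- x - y) = F (- y) + F x + G (- y) + G (- x).
  by have := FGNN y x; rewrite (addrC (- y)).
split=> [x|]; first by rewrite lnfE; congr expR; rewrite /P /l /r; lra.
split=> [x|]; first by rewrite lngE; congr expR; rewrite /P /m /r; lra.
split=> [x y|].
  rewrite /P !opprD opprK (addrC (- x) y).
  by have := FG x y; have := FGNr x y; have := FGNl x y; have := FGNN x y; lra.
split=> [x y|].
  by rewrite /l opprD; have := FG x y; have := FGs x y; lra.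
split=> [x y|].
  (* The instances at [(x, -y)] and [(-y, x)] share the term [F (x - y)], and their difference
     leaves only [G]. *)
  by rewrite /m opprD; have := FGNr x y; have := FGNrs x y; lra.
apply: constant_on_cosets_mul_image2 => x y.
rewrite /r !opprD opprK (addrC (- x) y).
(* Instances at [(x, y)] and [(-x, -y)] minus those at [(x, -y)] and [(-x, y)]: the right-hand sides
   cancel. *)
by have := FG x y; have := FGNr x y; have := FGNl x y; have := FGNN x y; lra.
Qed.
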